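(* Let $G=F\rtimes\mathbb{Z}$ be a semidirect product where $F$ is a free group of any cardinality (rank). Then every finitely generated subgroup $H$ of $G$ satisfies $\omega(H)\geq 3^{1/6}$, unless $H$ is isomorphic to $\{e\}$, $\mathbb{Z}$, $\mathbb{Z}\times\mathbb{Z}$ or the Klein bottle group.
   Context: For a finitely generated group $G$ and a finite generating set $A$ of $G$, let $\gamma_A(n)$ be the number of elements of $G$ of word length at most $n$ with respect to $A\cup A^{-1}$, and let $\omega(G,A)=\lim_{n\to\infty}\gamma_A(n)^{1/n}$ (the limit exists since $\gamma_A$ is submultiplicative). The growth constant of $G$ is $\omega(G)=\inf_A \omega(G,A)$, the infimum being over all finite generating sets $A$ of $G$. The Klein bottle group is $\langle a,t\mid tat^{-1}=a^{-1}\rangle$. *)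

(* Defs.v *)
From HB Require Import structures.
From mathcomp Require Import all_boot all_order all_algebra.
From mathcomp Require Import finmap.
From mathcomp Require Import all_classical all_reals all_analysis.
Import numFieldNormedType.Exports.

Set Implicit Arguments.
Unset Strict Implicit.
Unset Printing Implicit Defensive.

Local Open Scope classical_set_scope.
Local Open Scope group_scope.
Local Open Scope quotient_scope.

Definition isomorphic (G H : groupType) : Prop :=
  exists f : {multiplicative G -> H}, bijective f.

Section TrivialGroup.
Let mul (_ _ : unit) := tt.
Let inv (_ : unit) := tt.
Let mulA : associative mul. Proof. by []. Qed.
Let mul1 : left_id tt mul. Proof. by case. Qed.
Let mulr1 : right_id tt mul. Proof. by case. Qed.
Let mulV : left_inverse tt inv mul. Proof. by []. Qed.
Let mulrV : right_inverse tt inv mul. Proof. by []. Qed.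
HB.instance Definition _ := isGroup.Build unit mulA mul1 mulr1 mulV mulrV.
End TrivialGroup.

(* The additive group of int, in multiplicative notation *)
Notation Zgroup := (Algebra.to_multiplicative int).

(* The presented group < X | rel >, where rel u v stands for the relation     *)
(* u = v between words; the letter (x, false) is x and (x, true) is x^-1.     *)

Definition word (X : Type) := seq (X * bool).

Definition inv_word X (w : word X) : word X :=
  rev [seq (l.1, ~~ l.2) | l <- w].

Inductive word_eq X (rel : word X -> word X -> Prop) :
    word X -> word X -> Prop :=
| word_eq_refl u : word_eq rel u u
| word_eq_sym u v : word_eq rel u v -> word_eq rel v u
| word_eq_trans u v w : word_eq rel u v -> word_eq rel v w -> word_eq rel u w
| word_eq_cancel u v x b :
    word_eq rel (u ++ [:: (x, b); (x, ~~ b)] ++ v) (u ++ v)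
| word_eq_rel u v l r : rel l r -> word_eq rel (u ++ l ++ v) (u ++ r ++ v).

Section Presented.
Variables (X : choiceType) (rel : word X -> word X -> Prop).

Definition word_eqb (u v : word X) : bool := `[< word_eq rel u v >].

Lemma word_eqb_refl : reflexive word_eqb.
Proof. by move=> u; apply/asboolP; exact: word_eq_refl. Qed.

Lemma word_eqb_sym : ssrbool.symmetric word_eqb.
Proof.
by move=> u v; apply/asboolP/asboolP; exact: word_eq_sym.
Qed.

Lemma word_eqb_trans : ssrbool.transitive word_eqb.
Proof.
move=> v u w /asboolP uv /asboolP vw; apply/asboolP.
exact: word_eq_trans uv vw.
Qed.

Canonical word_eqb_equiv :=
  EquivRel word_eqb word_eqb_refl word_eqb_sym word_eqb_trans.

Definition presented := {eq_quot word_eqb}%qT.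
HB.instance Definition _ := Choice.on presented.
HB.instance Definition _ := EqQuotient.on presented.

Lemma word_eq_cat u u' v v' :
  word_eq rel u u' -> word_eq rel v v' -> word_eq rel (u ++ v) (u' ++ v').
Proof.
move=> uu' vv'; apply: (@word_eq_trans _ _ _ (u' ++ v)).
  elim: uu' => {u u'} [u|u w _|u w z _ + _|u w x b|u w l r lr].
  - exact: word_eq_refl.
  - exact: word_eq_sym.
  - exact: word_eq_trans.
  - by rewrite -!catA; exact: word_eq_cancel.
  - by rewrite -!catA; exact: word_eq_rel.
elim: vv' => {v v'} [v|v w _|v w z _ + _|v w x b|v w l r lr].
- exact: word_eq_refl.
- exact: word_eq_sym.
- exact: word_eq_trans.
- by rewrite !(catA u'); exact: word_eq_cancel.
- by rewrite !(catA u'); exact: word_eq_rel.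
Qed.

Lemma inv_word_cat (u v : word X) :
  inv_word (u ++ v) = inv_word v ++ inv_word u.
Proof. by rewrite /inv_word map_cat rev_cat. Qed.

Lemma inv_wordK : involutive (@inv_word X).
Proof.
move=> w; rewrite /inv_word map_rev revK -map_comp map_id_in//.
by move=> [x b] _ /=; rewrite negbK.
Qed.

Lemma word_eq_mulV u : word_eq rel (u ++ inv_word u) [::].
Proof.
elim/last_ind: u => [|u [x b] IH]; first exact: word_eq_refl.
rewrite -cats1 inv_word_cat -catA; apply: word_eq_trans IH.
exact: (word_eq_cancel rel u (inv_word u) x b).
Qed.

Lemma word_eq_Vmul u : word_eq rel (inv_word u ++ u) [::].
Proof. by have := word_eq_mulV (inv_word u); rewrite inv_wordK. Qed.

Lemma word_eq_inv u v : word_eq rel u v -> word_eq rel (inv_word u) (inv_word v).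
Proof.
move=> uv; apply: (@word_eq_trans _ _ _ (inv_word u ++ (v ++ inv_word v))).
  rewrite -[X in word_eq _ X _]cats0.
  by apply: word_eq_cat; [exact: word_eq_refl|apply/word_eq_sym/word_eq_mulV].
rewrite catA -[X in word_eq _ _ X]cat0s.
apply: word_eq_cat; last exact: word_eq_refl.
apply: word_eq_trans (word_eq_Vmul u).
by apply: word_eq_cat; [exact: word_eq_refl|exact: word_eq_sym].
Qed.

Lemma presentedP u v :
  reflect (word_eq rel u v) (\pi_presented u == \pi_presented v).
Proof. by rewrite eqmodE; exact: asboolP. Qed.

Lemma repr_presented u : word_eq rel (repr (\pi_presented u)) u.
Proof. by apply/presentedP; rewrite reprK. Qed.

Definition presented_one : presented := \pi_presented [::].
Definition presented_mul (p q : presented) : presented :=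
  \pi_presented (repr p ++ repr q).
Definition presented_inv (p : presented) : presented :=
  \pi_presented (inv_word (repr p)).

Lemma presented_mulA : associative presented_mul.
Proof.
move=> p q r; apply/eqP/presentedP.
apply: (@word_eq_trans _ _ _ (repr p ++ (repr q ++ repr r))).
  by apply: word_eq_cat; [exact: word_eq_refl|exact: repr_presented].
rewrite catA; apply: word_eq_sym.
by apply: word_eq_cat; [exact: repr_presented|exact: word_eq_refl].
Qed.

Lemma presented_mul1 : left_id presented_one presented_mul.
Proof.
move=> p; rewrite -[RHS]reprK; apply/eqP/presentedP.
rewrite -[X in word_eq _ _ X]cat0s.
by apply: word_eq_cat; [exact: repr_presented|exact: word_eq_refl].
Qed.

Lemma presented_mulr1 : right_id presented_one presented_mul.
Proof.
move=> p; rewrite -[RHS]reprK; apply/eqP/presentedP.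
rewrite -[X in word_eq _ _ X]cats0.
by apply: word_eq_cat; [exact: word_eq_refl|exact: repr_presented].
Qed.

Lemma presented_mulV : left_inverse presented_one presented_inv presented_mul.
Proof.
move=> p; apply/eqP/presentedP; apply: word_eq_trans (word_eq_Vmul (repr p)).
by apply: word_eq_cat; [exact: repr_presented|exact: word_eq_refl].
Qed.

Lemma presented_mulrV : right_inverse presented_one presented_inv presented_mul.
Proof.
move=> p; apply/eqP/presentedP; apply: word_eq_trans (word_eq_mulV (repr p)).
by apply: word_eq_cat; [exact: word_eq_refl|exact: repr_presented].
Qed.

HB.instance Definition _ := isGroup.Build presented
  presented_mulA presented_mul1 presented_mulr1 presented_mulV presented_mulrV.

End Presented.

Definition free_group (X : choiceType) : groupType :=
  presented (fun _ _ : word X => False).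

(* Classically every type is a choiceType, so the rank of F is arbitrary. *)
Definition is_free (F : groupType) : Prop :=
  exists X : choiceType, isomorphic F (free_group X).

(* < a, t | t a t^-1 = a^-1 >, with a := false and t := true *)
Definition klein_rel (u v : word bool) : Prop :=
  u = [:: (true, false); (false, false); (true, true)] /\
  v = [:: (false, true)].

Definition klein_bottle_group : groupType := presented klein_rel.

(* A morphism K -> Aut(N): each act k is bijective, with inverse act k^-1. *)
Record autaction (K N : groupType) := AutAction {
  act :> K -> N -> N;
  actM : forall k, {morph act k : x y / x * y};
  act_one : forall x, act 1 x = x;
  act_comp : forall k l x, act (k * l) x = act k (act l x) }.

Definition sdprod (K N : groupType) (phi : autaction K N) : Type :=
  (N * K)%type.

Section SemidirectProduct.
Variables (K N : groupType) (phi : autaction K N).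

HB.instance Definition _ := Choice.on (sdprod phi).

Definition sd_one : sdprod phi := (1, 1).
Definition sd_mul (p q : sdprod phi) : sdprod phi :=
  (p.1 * phi p.2 q.1, p.2 * q.2).
Definition sd_inv (p : sdprod phi) : sdprod phi :=
  (phi p.2^-1 p.1^-1, p.2^-1).

Lemma act_id k : phi k 1 = 1.
Proof. by apply: (@mulgI _ (phi k 1)); rewrite -actM !mulg1. Qed.

Lemma sd_mulA : associative sd_mul.
Proof.
by move=> p q r; rewrite /sd_mul /= actM act_comp !mulgA.
Qed.

Lemma sd_mul1 : left_id sd_one sd_mul.
Proof. by case=> x k; rewrite /sd_mul /= act_one !mul1g. Qed.

Lemma sd_mulr1 : right_id sd_one sd_mul.
Proof. by case=> x k; rewrite /sd_mul /= act_id !mulg1. Qed.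

Lemma sd_mulV : left_inverse sd_one sd_inv sd_mul.
Proof.
by case=> x k; rewrite /sd_mul /sd_inv /= -actM !mulVg act_id.
Qed.

Lemma sd_mulrV : right_inverse sd_one sd_inv sd_mul.
Proof.
by case=> x k; rewrite /sd_mul /sd_inv /= -act_comp !mulgV act_one mulgV.
Qed.

HB.instance Definition _ := isGroup.Build (sdprod phi)
  sd_mulA sd_mul1 sd_mulr1 sd_mulV sd_mulrV.

End SemidirectProduct.

Section Growth.
Variable G : groupType.
Implicit Type A : {fset G}.

Definition word_ball A (n : nat) : set G :=
  [set x | exists w : seq G, [/\ (size w <= n)%N,
     forall y, y \in w -> (y \in A) || (y^-1 \in A) & x = \prod_(y <- w) y]].

Definition generates A : Prop := forall x : G, exists n, word_ball A n x.

Definition finitely_generated : Prop := exists A, generates A.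

Lemma finite_word_ball A n : finite_set (word_ball A n).
Proof.
pose B := [set` A] `|` (fun x : G => x^-1) @` [set` A].
have finB : finite_set B.
  by rewrite finite_setU; split=> //; exact: finite_image.
elim: n => [|n IH].
  apply: (@sub_finite_set _ _ [set 1]) => // x [[|y w] [sw _ ->]] /=; last by [].
  by rewrite big_nil.
apply: (@sub_finite_set _ _
  ([set 1] `|` [set p.1 * p.2 | p in B `*` word_ball A n])); last first.
  rewrite finite_setU; split=> //.
  by apply: finite_image; exact: finite_setX.
move=> x [[|y w] [sw wA ->]]; first by left; rewrite big_nil.
right; exists (y, \prod_(z <- w) z); last by rewrite big_cons.
split=> /=; last first.
  by exists w; split=> // z zw; apply: wA; rewrite inE zw orbT.
have /orP[yA|yA] := wA y (mem_head _ _); first by left.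
by right; exists y^-1 => //; rewrite invgK.
Qed.

(* gamma_A; fset_set is meaningful here by finite_word_ball *)
Definition growth_function A (n : nat) : nat := #|` fset_set (word_ball A n)|.

Local Open Scope ring_scope.

Definition growth_rate (R : realType) A : R :=
  lim ((growth_function A n)%:R `^ (n%:R^-1) @[n --> \oo]).

Definition growth_constant (R : realType) : R :=
  inf [set growth_rate R A | A in [set A : {fset G} | generates A]].

End Growth.
Arguments growth_constant G R : clear implicits.

(* Main.v *)
Require Import Defs.
From HB Require Import structures.
From mathcomp Require Import all_boot all_order all_algebra.
From mathcomp Require Import finmap.
From mathcomp Require Import all_classical all_reals all_analysis.
From mathcomp Require Import zify.

(* In a free group two elements either generate a free group of rank 2 or lie   *)
(* in a common cyclic subgroup: shorten the pair by Nielsen moves and           *)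
(* conjugations; once this is impossible, either one of the two is trivial, or  *)
(* no letter cancels completely in a reduced word in the pair.                  *)
(* Let A be a finite generating set of H and K the intersection of H and F. If  *)
(* two elements of K of A-length at most 6 do not commute, they generate a free *)
(* group, so that gamma_A(6n) >= 3^n and gamma_A(n)^6 >= 3^n. Otherwise K is    *)
(* abelian: if the generators do not all commute, let c = [x, y] <> 1 with x, y *)
(* in A. Then c commutes with its conjugates by generators, which have length   *)
(* at most 6, so the centraliser of c in K is normal in H by transitivity of    *)
(* commutation; each h in K commutes with c because c commutes with c^h.        *)
(* Finally K = <u> is cyclic and H = <u><t> with u^t = u or u^t = u^-1.         *)

Set Implicit Arguments.
Unset Strict Implicit.
Unset Printing Implicit Defensive.

(** * Reduced words and free groups *)

(** Fix a finite generating set [A] of [H] and let [K] be the kernel of the projection of [H] to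
    [Zgroup]; it embeds in the free group [F]. If the ball of radius 6 contains a free pair, the
    reduced words of length [n] in that pair give at least [3 ^ n] elements of the ball of radius
    [6 * n], and submultiplicativity yields [3 ^ n <= growth_function A n ^ 6] ([free_pair_growth],
    [growth_rate_ge]). This bound does not depend on [A], so it passes to the infimum.

    Two elements of [K] that do not commute form a free pair ([tree_free_or_cyclic],
    [kernel_free_pair]). It remains to treat the case where all elements of [K] of length at most 6
    commute. The radius 6 is what is needed for a commutator of two generators (length 4, and in [K]
    because the quotient is abelian) conjugated by one more generator. In a free group commutation
    is transitive through a nontrivial element, and [x] commutes with [y] as soon as it commutes
    with [x ^ y]; these two facts spread the local commutation over all of [K] ([kernel_abelian]).
    An abelian subgroup of a free group is cyclic, so [H] is cyclic-by-cyclic with the quotient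
    acting by a sign, which leaves only the four excluded groups ([abelian_kernel_isomorphic]).

    All that is used about free groups is drawn from [tree_length]: a length and a common-prefix
    function satisfying the ultrametric inequality. Nielsen reduction then becomes arithmetic with
    these numbers. *)

Section Lcp.
Variable T : eqType.
Implicit Types u v w : seq T.

Fixpoint seq_lcp u v : nat :=
  if u is x :: u' then
    if v is y :: v' then if x == y then (seq_lcp u' v').+1 else 0 else 0
  else 0.

Lemma lcp_ultra u v w : minn (seq_lcp u v) (seq_lcp v w) <= seq_lcp u w.
Proof.
elim: u v w => [|x u IH] [|y v] [|z w] //=; rewrite ?minn0 ?min0n //.
case: eqP => [->|_]; last by rewrite min0n.
by case: eqP => _; [rewrite minnSS ltnS|rewrite minn0].
Qed.

Lemma lcp_take k u : k <= size u -> seq_lcp (take k u) u = k.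
Proof.
by elim: u k => [|x u IH] [|k] //=; rewrite ltnS => /IH; rewrite eqxx => ->.
Qed.

Lemma lcp_size u v : seq_lcp u v <= size u /\ seq_lcp u v <= size v.
Proof.
elim: u v => [|x u IH] [|y v] //=; case: eqP => // _.
by rewrite !ltnS; exact: IH.
Qed.

Lemma nth_lcp x0 i u v : i < seq_lcp u v -> nth x0 u i = nth x0 v i.
Proof.
by elim: u v i => [|x u IH] [|y v] //= [|i]; case: eqP => //= _; exact: IH.
Qed.

End Lcp.

Section Words.
Variable X : choiceType.
Implicit Types (l : X * bool) (u v w : word X).

Definition inv_letter l := (l.1, ~~ l.2).

Lemma inv_letterK : involutive inv_letter.
Proof. by case=> x b; rewrite /inv_letter /= negbK. Qed.

Lemma inv_letter_neq l : inv_letter l != l.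
Proof. by case: l => x []; rewrite /inv_letter xpair_eqE andbC. Qed.

Definition reduced w := sorted (fun l m => m != inv_letter l) w.

Definition push l w :=
  if w is m :: w' then if m == inv_letter l then w' else l :: w else [:: l].

Definition red w := foldr push [::] w.

Lemma reduced_behead l w : reduced (l :: w) -> reduced w.
Proof. exact: path_sorted. Qed.

Lemma push_reduced l w : reduced w -> reduced (push l w).
Proof.
case: w => //= m w mw; case: ifP => [_|/negbT lm].
  exact: path_sorted mw.
by rewrite /= lm.
Qed.

Lemma foldr_push_reduced u w : reduced w -> reduced (foldr push w u).
Proof. by move=> w_red; elim: u => //= l u; exact: push_reduced. Qed.

Lemma red_reduced w : reduced (red w).
Proof. exact: foldr_push_reduced. Qed.

Lemma push_id l w : reduced (l :: w) -> push l w = l :: w.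
Proof. by case: w => //= m w /andP[/negPf-> _]. Qed.

Lemma red_id w : reduced w -> red w = w.
Proof.
elim: w => //= l w IH lw; rewrite IH ?push_id //; exact: reduced_behead lw.
Qed.

Lemma pushK l w : reduced w -> push l (push (inv_letter l) w) = w.
Proof.
move=> w_red; rewrite {2}/push; case: w w_red => [|m w] mw.
  by rewrite /push eqxx.
case: ifP => [|_]; last by rewrite /push eqxx.
by rewrite inv_letterK => /eqP <-; exact: push_id.
Qed.

Lemma foldr_push_cat u v w :
  foldr push w (u ++ v) = foldr push (foldr push w v) u.
Proof. exact: foldr_cat. Qed.

Lemma red_cat u v : red (u ++ v) = foldr push (red v) u.
Proof. exact: foldr_cat. Qed.

(** By [pushK], opposite letters act on reduced words by mutually inverse maps, so a cancelling pair
    has no effect. This gives the uniqueness of reduced forms. *)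
Lemma red_word_eq u v : word_eq (fun _ _ => False) u v -> red u = red v.
Proof.
elim=> {u v} //= [u v w _ -> _ ->//|u v x b].
rewrite !red_cat /=; congr foldr.
by have -> : (x, ~~ b) = inv_letter (x, b) by []; rewrite pushK // red_reduced.
Qed.

Lemma word_eq_push (rel : word X -> word X -> Prop) l w :
  word_eq rel (push l w) (l :: w).
Proof.
case: w => [|m w] /=; first exact: word_eq_refl.
case: ifP => [/eqP->|_]; last exact: word_eq_refl.
by apply: word_eq_sym; case: l => x b; exact: (word_eq_cancel rel [::] w x b).
Qed.

Lemma word_eq_red (rel : word X -> word X -> Prop) w : word_eq rel (red w) w.
Proof.
elim: w => [|l w IH] /=; first exact: word_eq_refl.
apply: (word_eq_trans (word_eq_push _ _ _)).
rewrite -cat1s -(cat1s l w).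
by apply: word_eq_cat => //; exact: word_eq_refl.
Qed.

Lemma inv_word_cons l w : inv_word (l :: w) = rcons (inv_word w) (inv_letter l).
Proof. by rewrite /inv_word map_cons rev_cons. Qed.

Lemma inv_word_reduced w : reduced w -> reduced (inv_word w).
Proof.
rewrite /reduced /inv_word rev_sorted sorted_map; apply: sub_sorted => l m /=.
by apply: contraNN => /eqP /(can_inj inv_letterK) ->; rewrite inv_letterK.
Qed.

Lemma size_inv_word w : size (inv_word w) = size w.
Proof. by rewrite size_rev size_map. Qed.

(** What cancels between the inverse of [u] and [v] is exactly their common prefix, lost once from
    each factor. *)
Lemma size_foldr_push u v : reduced u -> reduced v ->
  size (foldr push v (inv_word u)) + 2 * seq_lcp u v = size u + size v.
Proof.
elim: u v => [|l u IH] [|m v] lu mv /=; rewrite ?muln0 ?addn0 //.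
  rewrite -[foldr _ _ _]/(red (inv_word (l :: u))) red_id ?inv_word_reduced //.
  by rewrite size_inv_word.
rewrite inv_word_cons; case: eqP => [lm|/eqP lm].
  rewrite -cats1 foldr_push_cat /= lm inv_letterK eqxx.
  have := IH v (reduced_behead lu) (reduced_behead mv); lia.
have cat_red : reduced (rcons (inv_word u) (inv_letter l) ++ m :: v).
  rewrite /reduced cat_rcons sorted_cat_cons -inv_word_cons.
  have := inv_word_reduced lu; rewrite /reduced => ->; rewrite /= inv_letterK.
  by move: mv; rewrite /reduced /= => ->; rewrite andbT eq_sym.
rewrite -[in foldr _ _ _](red_id mv) -red_cat red_id // size_cat size_rcons.
by rewrite size_inv_word muln0 addn0.
Qed.

(** If the common prefix reached the middle of [w], either the middle letter would be its own
    inverse (odd length) or the two middle letters would cancel (even length). *)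
Lemma lcp_inv_word w : reduced w -> w != [::] -> 2 * seq_lcp w (inv_word w) < size w.
Proof.
case: w => // l0 w; set v := l0 :: w => v_red _; rewrite ltnNge; apply/negP => le.
have [kw _] := lcp_size v (inv_word v); set k := seq_lcp _ _ in kw le.
have sz : 0 < size v by [].
have inv_nth i : i < k -> nth l0 v i = inv_letter (nth l0 v (size v - i.+1)).
  move=> ik; rewrite (nth_lcp l0 ik) /inv_word nth_rev ?size_map ?(leq_trans ik) //.
  by rewrite (nth_map l0) //; lia.
have [odd_v|even_v] := boolP (odd (size v)).
  have h : (size v)./2 < k by lia.
  have := inv_nth _ h; have -> : size v - (size v)./2.+1 = (size v)./2 by lia.
  by move=> /esym/eqP; rewrite (negPf (inv_letter_neq _)).
have h : (size v)./2.-1 < k by lia.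
have := inv_nth _ h.
have -> : size v - (size v)./2.-1.+1 = (size v)./2.-1.+1 by lia.
move=> eq_mid; move/(sortedP l0): v_red => /(_ (size v)./2.-1); rewrite eq_mid.
by rewrite inv_letterK eqxx => /(_ _)/negP; apply => //; lia.
Qed.

End Words.

Local Open Scope group_scope.

(** * Evaluation of words and presented groups *)

Section Eval.
Variables (X : choiceType) (G : groupType) (g : X -> G).
Implicit Types (l : X * bool) (u v w : word X).

Definition letter l := if l.2 then (g l.1)^-1 else g l.1.

Definition eval w := \prod_(l <- w) letter l.

Lemma eval_nil : eval [::] = 1.
Proof. exact: big_nil. Qed.

Lemma eval_cons l w : eval (l :: w) = letter l * eval w.
Proof. exact: big_cons. Qed.

Lemma eval_cat u v : eval (u ++ v) = eval u * eval v.
Proof. exact: big_cat. Qed.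

Lemma letter_inv l : letter (inv_letter l) = (letter l)^-1.
Proof. by case: l => x [] /=; rewrite /letter /= ?invgK. Qed.

Lemma eval_inv w : eval (inv_word w) = (eval w)^-1.
Proof.
elim: w => [|l w IH]; first by rewrite !eval_nil invg1.
by rewrite inv_word_cons -cats1 eval_cat IH !eval_cons eval_nil mulg1 letter_inv
  invgM.
Qed.

Lemma eval_word_eq (rel : word X -> word X -> Prop) u v :
  (forall p q, rel p q -> eval p = eval q) -> word_eq rel u v -> eval u = eval v.
Proof.
move=> rel_eval; elim=> {u v} //= [u v w _ -> _ ->//|u v x b|u v p q /rel_eval pq].
  rewrite !eval_cat !eval_cons.
  have -> : (x, ~~ b) = inv_letter (x, b) by [].
  by rewrite letter_inv mulVKg.
by rewrite !eval_cat pq.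
Qed.

Lemma eval_red w : eval (red w) = eval w.
Proof. by apply: (@eval_word_eq (fun _ _ => False)); last exact: word_eq_red. Qed.

End Eval.

Section Presented.
Variables (X : choiceType) (rel : word X -> word X -> Prop).
Implicit Types u v w : word X.

Definition word_class w : presented rel := \pi_(presented rel)%qT w.

Lemma word_classP u v : word_class u = word_class v <-> word_eq rel u v.
Proof. by split=> [/eqP|] ?; [|apply/eqP]; exact/presentedP. Qed.

Lemma repr_word_class w : word_eq rel (repr (word_class w)) w.
Proof. exact: repr_presented. Qed.

Lemma word_classK (p : presented rel) : word_class (repr p) = p.
Proof. exact: reprK. Qed.

Lemma word_class_cat u v : word_class (u ++ v) = word_class u * word_class v.
Proof.
by apply/word_classP; apply: word_eq_cat; apply: word_eq_sym; exact: repr_word_class.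
Qed.

Lemma word_class_inv w : word_class (inv_word w) = (word_class w)^-1.
Proof.
by apply/word_classP; apply: word_eq_inv; apply: word_eq_sym; exact: repr_word_class.
Qed.

Lemma eval_word_class w : eval (fun x => word_class [:: (x, false)]) w = word_class w.
Proof.
elim: w => [|[x b] w IH]; first by rewrite eval_nil.
rewrite eval_cons IH -cat1s word_class_cat; congr (_ * _).
by case: b; rewrite /letter //= -word_class_inv.
Qed.

End Presented.

Lemma free_word_classP (X : choiceType) (u v : word X) :
  word_class (fun _ _ : word X => False) u = word_class _ v <-> red u = red v.
Proof.
rewrite word_classP; split; first exact: red_word_eq.
move=> uv; apply: word_eq_trans (word_eq_red _ v).
by rewrite -uv; apply: word_eq_sym; exact: word_eq_red.
Qed.

(* The word length of a free group: [lcp x y] is the length of the common part  *)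
(* of the geodesics from 1 to x and to y in the Cayley tree.                    *)
Record tree_length (F : groupType) (len : F -> nat) (lcp : F -> F -> nat) : Prop :=
  TreeLength {
  tree_len_eq0 : forall x : F, len x = 0 -> x = 1;
  tree_len_lcp : forall x y : F, (len (x^-1 * y)%g + 2 * lcp x y = len x + len y)%N;
  tree_lcp_ultra : forall x y z : F, minn (lcp x y) (lcp y z) <= lcp x z;
  tree_prefix : forall (x : F) k, k <= len x -> exists s, len s = k /\ lcp s x = k;
  tree_lcp_inv : forall x : F, x != 1 -> (2 * lcp x x^-1%g < len x)%N }.

Section FreeTreeLength.
Variable X : choiceType.
Let cl : word X -> free_group X := word_class (fun _ _ => False).
Let nf (p : free_group X) := red (repr p).

Lemma nf_word_class w : nf (cl w) = red w.
Proof. by apply/free_word_classP; exact: word_classK. Qed.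

Lemma nf_reduced p : reduced (nf p).
Proof. exact: red_reduced. Qed.

Lemma word_class_nf p : cl (nf p) = p.
Proof.
by rewrite -[RHS]word_classK; apply/free_word_classP; rewrite red_id ?red_reduced.
Qed.

Lemma nf_inv p : nf p^-1 = inv_word (nf p).
Proof.
rewrite -{1}(word_class_nf p) -word_class_inv nf_word_class red_id //.
exact/inv_word_reduced/nf_reduced.
Qed.

Lemma nf_mul p q : nf (p * q) = foldr (@push X) (nf q) (nf p).
Proof.
rewrite -{1}(word_class_nf p) -{1}(word_class_nf q) -word_class_cat nf_word_class.
by rewrite red_cat (red_id (nf_reduced q)).
Qed.

Lemma free_group_tree_length :
  tree_length (fun p => size (nf p)) (fun p q => seq_lcp (nf p) (nf q)).
Proof.
split=> [p /size0nil p1|p q|p q r|p k kp|p p1].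
- by rewrite -[LHS]word_class_nf p1.
- by rewrite nf_mul nf_inv size_foldr_push ?nf_reduced.
- exact: lcp_ultra.
- exists (cl (take k (nf p))); rewrite nf_word_class red_id.
    by rewrite size_take_min lcp_take // (minn_idPl kp).
  by apply: take_sorted; exact: nf_reduced.
- rewrite nf_inv; apply: lcp_inv_word; first exact: nf_reduced.
  by apply: contraNN p1 => /eqP p1; rewrite -[p]word_class_nf p1.
Qed.

End FreeTreeLength.

Section Morph.
Variables (G H : groupType) (f : G -> H).
Hypothesis fM : {morph f : x y / x * y}.

Lemma morph_one : f 1 = 1.
Proof. by apply: (@mulgI _ (f 1)); rewrite -fM !mulg1. Qed.

Lemma morph_inv : {morph f : x / x^-1}.
Proof. by move=> x; apply: (@mulgI _ (f x)); rewrite -fM !mulgV morph_one. Qed.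

Lemma eval_morph (X : choiceType) (g : X -> G) (w : word X) :
  f (eval g w) = eval (f \o g) w.
Proof.
elim: w => [|[x b] w IH]; first by rewrite !eval_nil morph_one.
by rewrite !eval_cons fM IH; case: b; rewrite /letter //= morph_inv.
Qed.

Lemma morph_inj : (forall x, f x = 1 -> x = 1) -> injective f.
Proof.
by move=> f1 x y xy; apply/divg1_eq/f1; rewrite fM morph_inv xy mulgV.
Qed.

End Morph.

Lemma is_free_tree_length (F : groupType) : is_free F ->
  exists len lcp, @tree_length F len lcp.
Proof.
move=> [X [f f_bij]]; have [len_eq0 len_lcp ultra prefix lcp_inv] :=
  free_group_tree_length X.
have fM : {morph f : x y / x * y} by exact: gmulfM.
have [f' fK f'K] := f_bij.
exists (fun x => size (red (repr (f x)))),
  (fun x y => seq_lcp (red (repr (f x))) (red (repr (f y)))).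
split=> [x fx|x y|x y z|x k kx|x x1].
- by apply: (bij_inj f_bij); rewrite (morph_one fM); exact: len_eq0.
- by rewrite fM (morph_inv fM) len_lcp.
- exact: ultra.
- by have [s] := prefix _ _ kx; exists (f' s); rewrite f'K.
- rewrite (morph_inv fM); apply: lcp_inv; rewrite -(morph_one fM).
  by rewrite (bij_eq f_bij).
Qed.

(** * Integer powers, subgroups and Nielsen moves *)

Section Zpow.
Variable G : groupType.
Implicit Types (x y : G) (m n : int).

Definition zpow x n := match n with Posz k => x ^+ k | Negz k => x ^- k.+1 end.

Lemma zpow0 x : zpow x 0 = 1.
Proof. by []. Qed.

Lemma zpow1 x : zpow x 1 = x.
Proof. exact: expg1. Qed.

Lemma zpowS x n : zpow x (n + 1)%R = zpow x n * x.
Proof.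
case: n => [k|[|k]]; first by rewrite -expgSr -addn1.
  by rewrite /= expg1 mulVg.
have -> : (Negz k.+1 + 1 = Negz k)%R by lia.
by rewrite /= (expgS _ k.+1) invgM mulgVK.
Qed.

Lemma zpowB1 x n : zpow x (n - 1)%R = zpow x n * x^-1.
Proof. by rewrite -[in RHS](GRing.subrK 1%R n) zpowS mulgK. Qed.

Lemma zpowD x m n : zpow x (m + n)%R = zpow x m * zpow x n.
Proof.
elim/int_rect: n => [|n IH|n IH]; first by rewrite GRing.addr0 zpow0 mulg1.
  have -> : (m + n.+1%:Z = m + n%:Z + 1)%R by lia.
  have -> : (n.+1%:Z = n%:Z + 1)%R by lia.
  by rewrite !zpowS IH mulgA.
have -> : (m - n.+1%:Z = m - n%:Z - 1)%R by lia.
have -> : (- n.+1%:Z = - n%:Z - 1)%R by lia.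
by rewrite !zpowB1 IH mulgA.
Qed.

Lemma zpowN x n : zpow x (- n)%R = (zpow x n)^-1.
Proof.
by apply: (@mulgI _ (zpow x n)); rewrite -zpowD GRing.addrN mulgV.
Qed.

Lemma zpow1g n : zpow (1 : G) n = 1.
Proof. by case: n => k /=; rewrite expg1n ?invg1. Qed.

Lemma commute_zpow x m n : commute (zpow x m) (zpow x n).
Proof. by rewrite /commute -!zpowD GRing.addrC. Qed.

Lemma zpowM x m n : zpow x (m * n)%R = zpow (zpow x m) n.
Proof.
elim/int_rect: n => [|n IH|n IH]; first by rewrite GRing.mulr0 !zpow0.
  have -> : (m * n.+1%:Z = m * n%:Z + m)%R by lia.
  have -> : (n.+1%:Z = n%:Z + 1)%R by lia.
  by rewrite zpowS zpowD IH.
have -> : (m * (- n.+1%:Z) = m * (- n%:Z) - m)%R by lia.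
have -> : (- n.+1%:Z = - n%:Z - 1)%R by lia.
by rewrite zpowB1 -zpowN -IH -zpowD.
Qed.

Lemma zpowV x n : zpow x^-1 n = (zpow x n)^-1.
Proof.
have -> : x^-1 = zpow x (-1)%R by rewrite zpowN zpow1.
by rewrite -zpowM GRing.mulN1r zpowN.
Qed.

Lemma zpow_conj x y n : zpow x n ^ y = zpow (x ^ y) n.
Proof. by case: n => k /=; rewrite ?conjVg conjXg. Qed.

End Zpow.

Lemma zpow_morph (G H : groupType) (f : G -> H) x n :
  {morph f : x y / x * y} -> f (zpow x n) = zpow (f x) n.
Proof.
move=> fM; elim/int_rect: n => [|n IH|n IH]; first by rewrite !zpow0 morph_one.
  have -> : (n.+1%:Z = n%:Z + 1)%R by lia.
  by rewrite !zpowS fM IH.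
have -> : (- n.+1%:Z = - n%:Z - 1)%R by lia.
by rewrite !zpowB1 fM IH morph_inv.
Qed.

Lemma zpow_int (n : int) : zpow (1%R : Zgroup) n = n.
Proof.
elim/int_rect: n => // n IH.
  have {1}-> : (n.+1%:Z = n%:Z + 1)%R by lia.
  by rewrite zpowS IH -[LHS]/(n%:Z + 1)%R; lia.
have {1}-> : (- n.+1%:Z = - n%:Z - 1)%R by lia.
by rewrite zpowB1 IH -[LHS]/(- n%:Z - 1)%R; lia.
Qed.

Section Subgroups.
Variable G : groupType.

Record is_subgroup (P : G -> Prop) : Prop := IsSubgroup {
  subgroup1 : P 1;
  subgroupM : forall x y, P x -> P y -> P (x * y);
  subgroupV : forall x, P x -> P x^-1 }.

Lemma subgroup_eval (P : G -> Prop) (X : choiceType) (g : X -> G) w :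
  is_subgroup P -> (forall x, P (g x)) -> P (eval g w).
Proof.
move=> [P1 PM PV] Pg; elim: w => [|[x b] w IH]; first by rewrite eval_nil.
by rewrite eval_cons; apply: PM => //; case: b; rewrite /letter //=; apply: PV.
Qed.

Lemma zpow_subgroup z : is_subgroup (fun x : G => exists n, x = zpow z n).
Proof.
split; first by exists 0%R.
- by move=> x y [m ->] [n ->]; exists (m + n)%R; rewrite zpowD.
- by move=> x [n ->]; exists (- n)%R; rewrite zpowN.
Qed.

End Subgroups.

Section Pairs.

Definition subst (X Y : choiceType) (s : X -> word Y) (w : word X) : word Y :=
  flatten [seq if l.2 then inv_word (s l.1) else s l.1 | l <- w].

Lemma eval_subst (X Y : choiceType) (G : groupType) (g : Y -> G)
    (s : X -> word Y) w :
  eval g (subst s w) = eval (fun x => eval g (s x)) w.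
Proof.
elim: w => [|[x b] w IH]; first by rewrite !eval_nil.
rewrite eval_cons -IH /subst /= eval_cat; congr (_ * _).
by case: b; rewrite /letter //= eval_inv.
Qed.

(* A pair is free when every relation it satisfies holds in every group; this   *)
(* form is visibly invariant under Nielsen moves.                               *)
Definition free_pair (G : groupType) (g : bool -> G) : Prop :=
  forall (Q : groupType) (a : bool -> Q) w, eval g w = 1 -> eval a w = 1.

(** Freeness is tested in the free group on [bool] with its standard generators, where reduced forms
    are unique. *)
Lemma free_pair_inj (G : groupType) (g : bool -> G) v w : free_pair g ->
  reduced v -> reduced w -> eval g v = eval g w -> v = w.
Proof.
move=> g_free v_red w_red vw.
have : eval g (inv_word v ++ w) = 1 by rewrite eval_cat eval_inv vw mulVg.
move/(g_free _ (fun x => word_class (fun _ _ => False) [:: (x, false)])).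
rewrite eval_word_class word_class_cat word_class_inv => /mulg1_eq; rewrite invgK.
by move=> /free_word_classP; rewrite !red_id.
Qed.

(** The first clause places [z] in the subgroup generated by the pair, so that the common root stays
    inside every subgroup containing the pair. *)
Definition cyclic_pair (G : groupType) (g : bool -> G) : Prop :=
  exists z, (forall P, is_subgroup P -> (forall b, P (g b)) -> P z) /\
    forall b, exists n, g b = zpow z n.

Definition free_or_cyclic (G : groupType) (g : bool -> G) : Prop :=
  free_pair g \/ cyclic_pair g.

Variables (G : groupType) (g : bool -> G).

(** [s] writes the new pair in the old one and [t] inverts it by identities valid in every group, so
    relations and common roots can be carried back. *)
Lemma free_or_cyclic_subst (s t : bool -> word bool) :
  (forall (Q : groupType) (a : bool -> Q) x,
    eval (fun y => eval a (s y)) (t x) = a x) ->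
  free_or_cyclic (fun x => eval g (s x)) -> free_or_cyclic g.
Proof.
move=> st [g'_free|[z [zg gz]]]; [left=> Q a w gw|right].
  have st_id (K : groupType) (h : bool -> K) :
      eval (fun x => eval (fun y => eval h (s y)) (t x)) w = eval h w.
    by congr eval; apply/funext => x; exact: st.
  have := g'_free Q (fun x => eval a (s x)) (subst t w).
  by rewrite !eval_subst !st_id; exact.
exists z; split=> [P P_sub Pg|b].
  by apply: zg => // b; exact: subgroup_eval.
rewrite -(st _ g); apply: (subgroup_eval _ (zpow_subgroup z)) => x; exact: gz.
Qed.

Lemma free_or_cyclic_mul b e f :
  free_or_cyclic (fun c => if c == b then letter g (b, e) * letter g (~~ b, f)
                           else letter g (~~ b, f)) ->
  free_or_cyclic g.
Proof.
pose s c : word bool := if c == b then [:: (b, e); (~~ b, f)] else [:: (~~ b, f)].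
pose t c : word bool := if c == b then
  (if e then [:: (~~ b, false); (b, true)] else [:: (b, false); (~~ b, true)])
  else [:: (~~ b, f)].
move=> H; apply: (@free_or_cyclic_subst s t) => [Q a x|].
  by rewrite /s /t {s t H}; case: b e f x => [] [] [] [];
    rewrite /= ?eval_cons ?eval_nil /letter /= ?eval_cons ?eval_nil /letter /=;
    rewrite ?mulg1 ?invgM ?invgK ?mulgA ?mulgV ?mulVg ?mul1g ?mulgK ?mulgVK ?invgK.
have -> // : (fun x => eval g (s x)) = (fun c => if c == b then
  letter g (b, e) * letter g (~~ b, f) else letter g (~~ b, f)).
by apply/funext => c; rewrite /s; case: ifP; rewrite !eval_cons eval_nil mulg1.
Qed.

Lemma free_or_cyclic_conj s :
  free_or_cyclic (fun c => g c ^ s) -> free_or_cyclic g.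
Proof.
have conjM : {morph (fun x => x ^ s) : x y / x * y} by move=> x y; rewrite conjMg.
move=> [g'_free|[z [zg gz]]]; [left=> Q a w gw|right].
  apply: g'_free; rewrite -[LHS](eval_morph conjM) gw; exact: conj1g.
exists (z ^ s^-1); split=> [P [P1 PM PV] Pg|b].
  apply: (zg (fun x => P (x ^ s^-1))) => [|b]; last by rewrite conjgK.
  by split=> [|x y|x]; rewrite ?conj1g ?conjMg ?conjVg; auto.
have [n gn] := gz b; exists n.
by rewrite -zpow_conj -gn conjgK.
Qed.

End Pairs.

(** * The dichotomy for pairs of elements of a free group *)

Section TreeLength.
Variables (F : groupType) (len : F -> nat) (lcp : F -> F -> nat).
Hypothesis tl : tree_length len lcp.
Implicit Types (x y z s : F) (g : bool -> F).
Local Open Scope nat_scope.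

Let len_lcp := tree_len_lcp tl.
Let lcp_ultra := tree_lcp_ultra tl.

(* Merges the occurrences of [len] and [lcp] that differ only in the inferred   *)
(* structures, which [lia] does not identify.                                   *)
Ltac tree_lia :=
  repeat match goal with
  | H : context [len ?x] |- _ => move: H
  | H : context [lcp ?x ?y] |- _ => move: H
  end;
  repeat match goal with
  | |- context [len ?x] => move: (len x) => ?
  | |- context [lcp ?x ?y] => move: (lcp x y) => ?
  end; lia.

Lemma len1 : len 1%g = 0.
Proof.
have [s [s0 _]] := tree_prefix tl (leq0n (len 1%g)).
by rewrite -(tree_len_eq0 tl s0).
Qed.

Lemma len_inv x : len x^-1%g = len x.
Proof.
have le y : len y^-1%g <= len y.
  by have := len_lcp y 1%g; rewrite mulg1 len1; lia.
by apply/eqP; rewrite eqn_leq le -{1}[x]invgK le.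
Qed.

Lemma lcp1x x : lcp 1%g x = 0.
Proof.
have := len_lcp 1%g x; rewrite invg1 mul1g len1 add0n => /eqP.
by rewrite -[X in _ == X]addn0 eqn_add2l muln_eq0 => /eqP.
Qed.

Lemma lcpxx x : lcp x x = len x.
Proof. by have := len_lcp x x; rewrite mulVg len1; lia. Qed.

Lemma lcpC x y : lcp x y = lcp y x.
Proof.
have e : len (x^-1 * y)%g = len (y^-1 * x)%g by rewrite -len_inv invgM invgK.
by have := len_lcp x y; have := len_lcp y x; rewrite e; lia.
Qed.

Lemma lcp_le x y : lcp x y <= len x.
Proof. by have := lcp_ultra x y x; rewrite (lcpC y x) minnn lcpxx. Qed.

Lemma len_mul x y : len (x * y)%g + 2 * lcp x^-1%g y = len x + len y.
Proof. by have := len_lcp x^-1%g y; rewrite invgK len_inv. Qed.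

(** The part of [x] surviving at the start of [x * y] is what is left after the cancelled tail, of
    length [lcp x^-1 y]. *)
Lemma lcp_mul x y : lcp (x * y)%g x + lcp x^-1%g y = len x.
Proof.
have := len_lcp (x * y)%g x; have := len_mul x y.
by rewrite invgM mulgVK len_inv; lia.
Qed.

Lemma lcp_isosceles x y z : lcp x y < lcp x z -> lcp z y = lcp x y.
Proof.
by have := lcp_ultra z x y; have := lcp_ultra x z y; rewrite (lcpC z x); lia.
Qed.

(** In a reduced word the letter [b] loses [lcp b^-1 p] to its successor [p] and [lcp b q] to its
    predecessor, the inverse of [q]. The condition says that some of [b] always survives. *)
Definition nielsen_reduced g := forall b p q : bool * bool,
  p != inv_letter b -> q != b ->
  lcp (letter g b)^-1%g (letter g p) + lcp (letter g b) (letter g q) < len (letter g b).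

(** The value of a reduced word agrees with its first letter for longer than any other letter does.
    By induction the tail agrees with its own first letter [m] so far that its cancellation against
    [l] is that of [m] alone. *)
Lemma nielsen_reduced_lcp g l w q : nielsen_reduced g -> reduced (l :: w) ->
  q != l -> lcp (letter g l) (letter g q) < lcp (eval g (l :: w)) (letter g l).
Proof.
move=> g_red; elim: w l q => [|m w IH] l q lw ql.
  rewrite eval_cons eval_nil mulg1 lcpxx.
  by have := g_red l l q; rewrite eq_sym inv_letter_neq => /(_ isT ql); lia.
have [ml mw] : m != inv_letter l /\ reduced (m :: w) by move: lw => /andP[].
have lm : inv_letter l != m by rewrite eq_sym.
rewrite eval_cons; have := lcp_mul (letter g l) (eval g (m :: w)).
have := IH m _ mw lm; rewrite letter_inv (lcpC (eval _ _)) => /lcp_isosceles.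
rewrite lcpC (lcpC (letter g m)) => ->.
move=> e_len; rewrite -(ltn_add2r (lcp (letter g l)^-1%g (letter g m))) e_len addnC.
exact: g_red.
Qed.

Lemma nielsen_reduced_free g : nielsen_reduced g -> free_pair g.
Proof.
move=> g_red Q a w; rewrite -(eval_red g) -(eval_red a).
case: (red w) (red_reduced w) => [|l v]; first by rewrite !eval_nil.
move=> lv /(congr1 (fun x => lcp x (letter g l))); rewrite lcp1x => eq0.
have := nielsen_reduced_lcp g_red lv (inv_letter_neq l).
by rewrite eq0.
Qed.

(** Write [x = s r] with both halves of length [m]; then [a] starts with [s] and ends with [r], say
    [a = s a' r]. Hence [a * x^-1 = s a' s^-1], whose conjugate by [s] is [a'], while [x^-1] becomes
    [s^-1 r^-1]. *)
Lemma conj_shorter x a m : len x = 2 * m -> 2 * m <= len a -> lcp x a = m ->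
  lcp x^-1%g a^-1%g = m ->
  exists s, len ((a * x^-1) ^ s)%g + 2 * m <= len a /\ len (x^-1 ^ s)%g <= 2 * m.
Proof.
move=> xm am xa xaV.
have [s [sm sa]] : exists s, len s = m /\ lcp s a = m by apply: (tree_prefix tl); lia.
pose h := (a * x^-1)%g; exists s.
have sx : m <= lcp s x by have := lcp_ultra s a x; rewrite (lcpC a); lia.
have len_h : len h = len a.
  by have := len_mul a x^-1%g; rewrite lcpC xaV len_inv -/h; tree_lia.
have sh : m <= lcp s h.
  have := len_lcp a h; rewrite /h mulKg -/h len_inv.
  by have := lcp_ultra s a h; tree_lia.
have len_sh : len (s^-1 * h)%g + m <= len a by have := len_lcp s h; tree_lia.
have hs : m <= lcp h^-1%g s.
  have := len_mul h x; rewrite /h mulgVK -/h.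
  by have := lcp_ultra h^-1%g x s; rewrite (lcpC x); tree_lia.
have hss : m <= lcp (s^-1 * h)^-1%g s.
  rewrite invgM invgK; have := lcp_ultra (h^-1 * s)%g h^-1%g s.
  have := lcp_mul h^-1%g s; rewrite invgK (lcpC h) len_inv.
  have := lcp_le s h; tree_lia.
split.
  rewrite -/h; have := len_mul (s^-1 * h)%g s; rewrite -mulgA -/(conjg h s).
  by tree_lia.
rewrite conjVg len_inv conjgE mulgA.
have := len_mul (s^-1 * x)%g s; have := len_lcp s x; tree_lia.
Qed.

(** If no product shortens the pair, a letter can be consumed only when exactly half of it cancels
    on each side, against the other generator. That is the situation of [conj_shorter]. *)
Lemma nielsen_reduced_or_move g : (forall b, g b != 1%g) ->
  [\/ nielsen_reduced g,
      exists b e f, len (letter g (b, e) * letter g (~~ b, f))%g < len (g b)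
    | exists b e f s, len ((letter g (b, e) * letter g (~~ b, f)) ^ s)%g +
        len (letter g (~~ b, f) ^ s)%g < len (g false) + len (g true)].
Proof.
move=> g_neq1; have [g_red|g_nred] := pselect (nielsen_reduced g).
  by constructor 1.
have [ex|nex] := pselect (exists b e f,
  len (letter g (b, e) * letter g (~~ b, f))%g < len (g b)).
  by constructor 2.
constructor 3.
have len_letter b e : len (letter g (b, e)) = len (g b).
  by case: e; rewrite /letter /= ?len_inv.
have letterV b e : (letter g (b, e))^-1%g = letter g (b, ~~ e).
  by rewrite -letter_inv.
(* Since no product is shorter than either factor, at most half of each factor cancels. *)
have half b e f : 2 * lcp (letter g (b, e)) (letter g (~~ b, f)) <= len (g b) /\
    2 * lcp (letter g (b, e)) (letter g (~~ b, f)) <= len (g (~~ b)).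
  have H c e' f' : len (g c) <= len (letter g (c, e') * letter g (~~ c, f'))%g.
    by rewrite leqNgt; apply/negP => lt; apply: nex; exists c, e', f'.
  have := H b (~~ e) f; have := H (~~ b) (~~ f) e.
  have := len_mul (letter g (b, ~~ e)) (letter g (~~ b, f)).
  have := len_mul (letter g (~~ b, ~~ f)) (letter g (b, e)).
  rewrite !letterV !negbK !len_letter (lcpC (letter g (~~ b, f))).
  tree_lia.
have lt_half b e : 2 * lcp (letter g (b, e)) (letter g (b, ~~ e)) < len (g b).
  rewrite -letterV -(len_letter b e); apply: (tree_lcp_inv tl).
  by case: e; rewrite /letter //= invg_eq1.
have neqN (c b : bool) : c != b -> c = ~~ b by case: c b => [] [].
have bound b e p : p != (b, e) ->
    2 * lcp (letter g (b, e)) (letter g p) < len (g b) + (p.1 != b).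
  case: p => c f; have [->|cb] := eqVneq c b => /= pb.
    have -> : f = ~~ e by case: e f pb => [] []; rewrite ?eqxx.
    by rewrite addn0.
  rewrite (neqN _ _ cb).
  by rewrite addn1 ltnS; exact: (half b e f).1.
have [b [e [p [q [pb qb fail]]]]] : exists b e p q, [/\ p != (b, ~~ e), q != (b, e) &
    len (g b) <= lcp (letter g (b, ~~ e)) (letter g p) +
      lcp (letter g (b, e)) (letter g q)].
  apply: contrapT => no; apply: g_nred => -[b e] p q pb qb.
  rewrite ltnNge; apply/negP; rewrite len_letter letterV => le.
  by apply: no; exists b, e, p, q.
have pk := bound _ _ _ pb; have qk := bound _ _ _ qb.
have [p1 q1] : p.1 = ~~ b /\ q.1 = ~~ b.
  by split; apply: neqN; apply/eqP => eqb; move: pk qk; rewrite eqb eqxx;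
    case: (_ != b) => /=; tree_lia.
have [f p_def] : exists f, p = (~~ b, f) by exists p.2; rewrite -p1; case: (p).
have [f' q_def] : exists f', q = (~~ b, f') by exists q.2; rewrite -q1; case: (q).
have negb_neq : ~~ b != b by case: (b).
rewrite p1 q1 negb_neq /= in pk qk.
(* If [p] and [q] were equal, the letter and its inverse would share half their length through the
   ultrametric inequality, against [lt_half]. *)
have f'_def : f' = ~~ f.
  have := lt_half b e.
  have := lcp_ultra (letter g (b, e)) (letter g p) (letter g (b, ~~ e)).
  move: pk qk fail; rewrite p_def q_def (lcpC (letter g (~~ b, f))).
  by case: f f' {p_def q_def} => [] [] //=; tree_lia.
pose m := lcp (letter g (b, e)) (letter g q).
have [||||s [s1 s2]] := @conj_shorter (letter g (b, e)) (letter g q) m.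
- rewrite len_letter /m; tree_lia.
- rewrite q_def len_letter /m q_def; exact: (half b e f').2.
- by [].
- rewrite letterV q_def f'_def letterV negbK -p_def /m.
  by tree_lia.
exists (~~ b), f', (~~ e), s; rewrite negbK -letterV -q_def.
have m_gt0 : 0 < len (g b).
  by rewrite lt0n; apply: contraNneq (g_neq1 b) => /(tree_len_eq0 tl) ->.
have len_m : len (g b) = 2 * m.
  rewrite /m; tree_lia.
have -> : len (g false) + len (g true) = len (g b) + len (letter g q).
  by rewrite q_def len_letter; case: (b) => //; rewrite addnC.
tree_lia.
Qed.

Lemma tree_free_or_cyclic g : free_or_cyclic g.
Proof.
have [n] := ubnP (len (g false) + len (g true)).
elim: n g => // n IH g /ltnSE len_g.
have len_b b : len (g b) + len (g (~~ b)) = len (g false) + len (g true).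
  by case: b => //; rewrite addnC.
have [[b gb1]|g_neq1] := pselect (exists b, g b = 1%g).
  right; exists (g (~~ b)); split=> [P _|c]; first exact.
  have [->|cb] := eqVneq c b; first by exists 0%R.
  by exists 1%R; rewrite zpow1; case: c b cb {gb1} => [] [].
have [|g_red|[b [e [f lt]]]|[b [e [f [s lt]]]]] := @nielsen_reduced_or_move g.
- by move=> b; apply/eqP => gb1; apply: g_neq1; exists b.
- by left; exact: nielsen_reduced_free.
- apply: (@free_or_cyclic_mul _ _ b e f); apply: IH; have := len_b b.
  have : len (letter g (~~ b, f)) = len (g (~~ b)).
    by case: (f); rewrite /letter /= ?len_inv.
  by move: lt len_g; case: (b) => /=; tree_lia.
- apply: (@free_or_cyclic_mul _ _ b e f); apply: (@free_or_cyclic_conj _ _ s).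
  by apply: IH; move: lt len_g; case: (b) => /=; tree_lia.
Qed.

(** Each further factor [x] adds [len x - 2 * lcp x x^-1], which is positive: the powers keep
    starting like [x] beyond the point where [x] and [x^-1] part. *)
Lemma len_expg x n : x != 1%g -> len x < len (x ^+ n.+2)%g.
Proof.
move=> /(tree_lcp_inv tl) lt.
have step y : lcp x x^-1%g < lcp y x ->
    lcp x x^-1%g < lcp (x * y)%g x /\ len y < len (x * y)%g.
  rewrite (lcpC y) => /lcp_isosceles; rewrite lcpC => e.
  by have := lcp_mul x y; have := len_mul x y; rewrite !e; tree_lia.
have x_gt : lcp x x^-1%g < lcp x x by rewrite lcpxx; tree_lia.
have H m : lcp x x^-1%g < lcp (x ^+ m.+1)%g x by elim: m => // m /step[].
elim: n => [|n IH]; first by have [] := step _ x_gt.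
by apply: ltn_trans IH _; have [] := step _ (H n.+1).
Qed.

End TreeLength.

(** * Roots and commutation in free groups *)

Section FreeProperties.
Variable F : groupType.
Hypothesis freeF : is_free F.
Implicit Types (x y z u : F).

Lemma free_dichotomy (g : bool -> F) : free_or_cyclic g.
Proof.
by have [len [lcp tl]] := is_free_tree_length freeF; exact: tree_free_or_cyclic tl g.
Qed.

Lemma free_zpow_eq1 x n : x != 1 -> zpow x n = 1 -> n = 0%R.
Proof.
have [len [lcp tl]] := is_free_tree_length freeF => x1.
have H m : x ^+ m.+1 <> 1.
  case: m => [|m xm]; first by rewrite expg1; exact/eqP.
  by have := len_expg tl m x1; rewrite xm (len1 tl).
case: n => [[|m]|m] //= eq1; first by have := H m eq1.
by case: (H m); apply/eqP; rewrite -invg_eq1 eq1.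
Qed.

Lemma free_pair_not_commute (G : groupType) (g : bool -> G) :
  free_pair g -> ~ commute (g false) (g true).
Proof.
move=> g_free com.
have := @free_pair_inj _ g [:: (false, false); (true, false)]
  [:: (true, false); (false, false)] g_free isT isT.
by rewrite !eval_cons eval_nil /letter /= !mulg1 => /(_ com).
Qed.

Lemma commute_cyclic_pair (g : bool -> F) :
  commute (g false) (g true) -> cyclic_pair g.
Proof.
by move=> com; have [/free_pair_not_commute|] := free_dichotomy g.
Qed.

Lemma cyclic_pair_commute (G : groupType) (g : bool -> G) b c :
  cyclic_pair g -> commute (g b) (g c).
Proof.
by move=> [z [_ gz]]; have [m ->] := gz b; have [n ->] := gz c; exact: commute_zpow.
Qed.

Definition two_gen x y : bool -> F := fun b => if b then y else x.

Lemma commute_common_root x y : commute x y ->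
  exists z m n, x = zpow z m /\ y = zpow z n.
Proof.
move=> /(@commute_cyclic_pair (two_gen x y))[z [_ zg]].
by have [m ?] := zg false; have [n ?] := zg true; exists z, m, n.
Qed.

Definition word_zpow (n : int) (b : bool) : word bool :=
  match n with Posz k => nseq k (b, false) | Negz k => nseq k.+1 (b, true) end.

Lemma eval_word_zpow (G : groupType) (g : bool -> G) n b :
  eval g (word_zpow n b) = zpow (g b) n.
Proof.
have H l k : eval g (nseq k l) = letter g l ^+ k.
  by elim: k => [|k IH]; rewrite ?eval_nil //= eval_cons IH expgS.
by case: n => k; rewrite [LHS]H /letter //= expVgn.
Qed.

(* Map the two generators to 1 and 0 in Z. *)
Lemma free_pair_zpow (G : groupType) (g : bool -> G) m n :
  free_pair g -> zpow (g false) m = zpow (g true) n -> m = 0%R.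
Proof.
move=> g_free eq_mn.
have := g_free Zgroup (fun b => if b then 0%R else 1%R)
  (word_zpow m false ++ inv_word (word_zpow n true)).
rewrite !eval_cat !eval_inv !eval_word_zpow eq_mn mulgV => /(_ erefl).
rewrite (zpow1g Zgroup) zpow_int => eq1.
by rewrite -[LHS]GRing.subr0.
Qed.

(** The element [y] is a power of a root shared with [x] and of a root shared with [z]. As [y] is
    nontrivial these two roots satisfy a relation, so they have a common root. *)
Lemma commute_free_trans x y z :
  y != 1 -> commute x y -> commute y z -> commute x z.
Proof.
move=> y1 /commute_common_root[u [k [m [-> yu]]]].
move=> /commute_common_root[v [n [l [yv ->]]]].
have [/free_pair_zpow uv|] := free_dichotomy (two_gen u v).
  by have := uv m n; rewrite -yu -yv => /(_ erefl) m0; rewrite yu m0 eqxx in y1.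
move=> [w [_ wuv]]; have [i /= ->] := wuv false; have [j /= ->] := wuv true.
by rewrite -!zpowM; exact: commute_zpow.
Qed.

(** Otherwise [x] and [y] form a free pair, and the distinct reduced words [y^-1 x y x] and
    [x y^-1 x y] would have the same value. *)
Lemma commute_free_conj x y : commute (x ^ y) x -> commute x y.
Proof.
move=> com; have [g_free|] := free_dichotomy (two_gen x y); last first.
  exact: (@cyclic_pair_commute _ _ false true).
pose X : bool * bool := (false, false); pose Y : bool * bool := (true, false).
have := @free_pair_inj _ _ [:: inv_letter Y; X; Y; X] [:: X; inv_letter Y; X; Y]
  g_free isT isT.
rewrite !eval_cons eval_nil !letter_inv /letter /= !mulg1.
by move: com; rewrite /commute conjgE !mulgA => -> /(_ erefl).
Qed.

(** A shortest nontrivial element [u] of [P] generates it: [u] and [x] are powers of some [z] in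
    [P], and by [len_expg] a power of [z] no longer than [z] has exponent 1 or -1, unless it is
    trivial. *)
Lemma free_abelian_cyclic (P : F -> Prop) : is_subgroup P ->
  (forall x y, P x -> P y -> commute x y) ->
  exists u, P u /\ forall x, P x -> exists n, x = zpow u n.
Proof.
move=> P_sub P_com; have [len [lcp tl]] := is_free_tree_length freeF.
have [[x0 [Px0 x01]]|P_triv] := pselect (exists x, P x /\ x != 1); last first.
  exists 1; split; first exact: subgroup1 P_sub.
  move=> x Px; exists 0%R; apply: contrapT => /eqP x1; apply: P_triv.
  by exists x.
pose Q n := `[< exists x, [/\ P x, x != 1 & len x = n] >].
have exQ : exists n, Q n by exists (len x0); apply/asboolP; exists x0.
case: (ex_minnP exQ) => n /asboolP[u [Pu u1 un]] min.
exists u; split=> // x Px.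
have [z [zux uxz]] := @commute_cyclic_pair (two_gen u x) (P_com _ _ Pu Px).
have Pz : P z by apply: zux => //; case.
have [m /= um] := uxz false; have [k /= xk] := uxz true.
have z1 : z != 1 by apply: contraNneq u1 => z1; rewrite um z1 zpow1g.
have le_uz : len u <= len z by rewrite un; apply: min; apply/asboolP; exists z.
have [m1|mN1] : m = 1%R \/ m = (-1)%R.
  case: m um => [[|[|m]]|[|m]] um; [|by left| |by right|].
  - by rewrite um eqxx in u1.
  - by have := len_expg tl m z1; rewrite -[_ ^+ _]um; lia.
  - have := len_expg tl m z1.
    by rewrite -[len (_ ^+ _)](len_inv tl) -[(_ ^+ _)^-1]um; lia.
- by exists k; rewrite xk um m1 zpow1.
- by exists (- k)%R; rewrite xk um mN1 -zpowM GRing.mulN1r GRing.opprK.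
Qed.

End FreeProperties.

(** * Growth *)

Section ReducedWords.
Definition letters : seq (bool * bool) :=
  [:: (false, false); (false, true); (true, false); (true, true)].

Fixpoint reduced_words n : seq (word bool) :=
  if n is k.+1 then
    [seq l :: w | w <- reduced_words k, l <- [seq l <- letters | reduced (l :: w)]]
  else [:: [::]].

Lemma reduced_wordsS n : reduced_words n.+1 = [seq l :: w | w <- reduced_words n,
  l <- [seq l <- letters | reduced (l :: w)]].
Proof. by []. Qed.

Lemma reduced_wordsP n w : w \in reduced_words n -> reduced w /\ size w = n.
Proof.
elim: n w => [|n IH] w; first by rewrite inE => /eqP->.
rewrite reduced_wordsS => /allpairsPdep[v [l [/IH[_ <-] lv ->]]]; split=> //.
by move: lv; rewrite mem_filter => /andP[].
Qed.

Lemma reduced_words_uniq n : uniq (reduced_words n).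
Proof.
elim: n => // n IH; rewrite reduced_wordsS; apply: allpairs_uniq_dep => //.
- by move=> w _; rewrite filter_uniq.
- by move=> [v l] [w m] _ _ /= [-> ->].
Qed.

(** A reduced word can be extended on the left by every letter except the inverse of its first
    one. *)
Lemma size_reduced_words n : 3 ^ n <= size (reduced_words n).
Proof.
elim: n => // n IH; rewrite reduced_wordsS size_allpairs_dep expnS.
have H s : {in s, forall w, reduced w} ->
    3 * size s <= sumn [seq size [seq l <- letters | reduced (l :: w)] | w <- s].
  elim: s => //= w s IHs s_red; rewrite mulnS leq_add //; last first.
    by apply: IHs => v vs; apply: s_red; rewrite inE vs orbT.
  have : reduced w by apply: s_red; rewrite mem_head.
  by case: w {s_red} => // -[[] []] w /= ->.
by apply: leq_trans (H _ _) => [|w /reduced_wordsP[]//]; rewrite leq_mul2l IH.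
Qed.

End ReducedWords.

Section Balls.
Variables (G : groupType) (A : {fset G}).
Implicit Types (x y : G) (m n : nat).

Lemma word_ball1 n : word_ball A n 1.
Proof. by exists [::]; rewrite big_nil. Qed.

Lemma word_ballM m n x y :
  word_ball A m x -> word_ball A n y -> word_ball A (m + n) (x * y).
Proof.
move=> [u [um uA ->]] [v [vn vA ->]]; exists (u ++ v).
split; [by rewrite size_cat leq_add| |by rewrite big_cat].
by move=> z; rewrite mem_cat => /orP[/uA|/vA].
Qed.

Lemma word_ballV n x : word_ball A n x -> word_ball A n x^-1.
Proof.
move=> [u [un uA ->]]; exists (rev [seq y^-1 | y <- u]).
split; first by rewrite size_rev size_map.
  by move=> z; rewrite mem_rev => /mapP[y /uA yA ->]; rewrite invgK orbC.
by rewrite -map_rev big_map prodgV revK.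
Qed.

Lemma word_ball_leq m n x : m <= n -> word_ball A m x -> word_ball A n x.
Proof. by move=> mn [u [um uA ->]]; exists u; split=> //; exact: leq_trans mn. Qed.

Lemma word_ball_gen x : (x \in A) || (x^-1 \in A) -> word_ball A 1 x.
Proof.
by move=> xA; exists [:: x]; rewrite big_seq1; split=> // y; rewrite inE => /eqP->.
Qed.

Lemma word_ball_split m n x : word_ball A (m + n) x ->
  exists y z, [/\ word_ball A m y, word_ball A n z & x = y * z].
Proof.
move=> [u [um uA ->]]; exists (\prod_(y <- take m u) y), (\prod_(y <- drop m u) y).
split; last by rewrite -big_cat cat_take_drop.
- by exists (take m u); split=> // [|y /mem_take/uA//]; rewrite size_take_min geq_minl.
- by exists (drop m u); split=> // [|y /mem_drop/uA//]; rewrite size_drop leq_subLR.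
Qed.

Lemma word_ball_ind (P : G -> Prop) : P 1 ->
  (forall x y, (x \in A) || (x^-1 \in A) -> P y -> P (x * y)) ->
  forall n x, word_ball A n x -> P x.
Proof.
move=> P1 PM n x [u [_ uA ->]] {n x}.
elim: u uA => [|y u IH] uA; first by rewrite big_nil.
rewrite big_cons; apply: PM; first by apply: uA; rewrite mem_head.
by apply: IH => z zu; apply: uA; rewrite inE zu orbT.
Qed.

Lemma word_ball_eval k (g : bool -> G) w : (forall b, word_ball A k (g b)) ->
  word_ball A (k * size w) (eval g w).
Proof.
move=> gk; elim: w => [|[b e] w IH]; first by rewrite eval_nil; exact: word_ball1.
rewrite eval_cons mulnS; apply: word_ballM => //.
by case: e; rewrite /letter //=; apply: word_ballV.
Qed.

Lemma leq_growth n (s : seq G) : uniq s -> (forall x, x \in s -> word_ball A n x) ->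
  size s <= growth_function A n.
Proof.
move=> s_uniq sA; rewrite -(undup_id s_uniq) -card_fseq; apply: fsubset_leq_card.
apply/fsubsetP => x xs; rewrite in_fset_set; last exact: finite_word_ball.
by apply/mem_set/sA; rewrite inE in xs.
Qed.

Lemma growth_leq n (s : seq G) : (forall x, word_ball A n x -> x \in s) ->
  growth_function A n <= size s.
Proof.
move=> As; apply: leq_trans (size_undup s); rewrite -card_fseq.
apply: fsubset_leq_card; apply/fsubsetP => x.
rewrite in_fset_set; last exact: finite_word_ball.
by move=> /set_mem/As xs; rewrite inE.
Qed.

Lemma growth_gt0 n : 0 < growth_function A n.
Proof.
apply: (@leq_growth n [:: 1]) => // x; rewrite inE => /eqP->; exact: word_ball1.
Qed.

Lemma growth_submul m n :
  growth_function A (m + n) <= growth_function A m * growth_function A n.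
Proof.
pose ball k := enum_fset (fset_set (word_ball A k)).
rewrite -[leqRHS]/(size (ball m) * size (ball n))%N.
rewrite -(size_allpairs (fun x y : G => x * y)).
apply: growth_leq => x /word_ball_split[y [z [ym zn ->]]].
by apply: allpairs_f; rewrite in_fset_set ?mem_set //; exact: finite_word_ball.
Qed.

Lemma growth_expn k n : growth_function A (k * n) <= growth_function A n ^ k.
Proof.
elim: k => [|k IH].
  apply: (@growth_leq _ [:: 1]) => x /= [[|y u] [//= _ _ ->]].
  by rewrite big_nil mem_head.
rewrite mulSn expnS; apply: leq_trans (growth_submul _ _) _.
by rewrite leq_mul2l IH orbT.
Qed.

Lemma free_pair_growth k (g : bool -> G) n : free_pair g ->
  (forall b, word_ball A k (g b)) -> 3 ^ n <= growth_function A n ^ k.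
Proof.
move=> g_free gk; apply: leq_trans (growth_expn _ _).
apply: leq_trans (size_reduced_words n) _; rewrite -(size_map (eval g)).
apply: leq_growth => [|_ /mapP[w /reduced_wordsP[_ <-] ->]]; last first.
  exact: word_ball_eval.
rewrite map_inj_in_uniq ?reduced_words_uniq // => v w.
by move=> /reduced_wordsP[v_red _] /reduced_wordsP[w_red _]; exact: free_pair_inj.
Qed.

End Balls.

Import Order.TTheory GRing.Theory Num.Theory numFieldNormedType.Exports.

(** * Fekete's lemma and existence of the growth rate *)

Section Fekete.
Variable R : realType.
Local Open Scope classical_set_scope.
Local Open Scope ring_scope.

Lemma fekete (v : nat -> R) : (forall n, 0 <= v n) ->
  (forall m n, v (m + n)%N <= v m + v n) ->
  cvg (v n / n%:R @[n --> \oo]).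
Proof.
move=> v_ge0 v_sub; pose E := [set v n.+1 / n.+1%:R | n in [set: nat]].
have E_inf : has_inf E.
  split; first by exists (v 1%N / 1); exists 0%N.
  by exists 0 => _ [n _ <-]; rewrite divr_ge0.
have v_mul m q r : v (q * m + r)%N <= q%:R * v m + v r.
  elim: q => [|q IH]; first by rewrite mul0r add0r.
  rewrite mulSn -addnA (le_trans (v_sub _ _)) //.
  by rewrite -natr1 mulrDl mul1r addrAC addrC lerD2l.
apply/cvg_ex; exists (inf E); apply/cvgrPdist_le => eps eps0.
have [_ [m _ <-] m_lt] := inf_adherent (divr_gt0 eps0 (@ltr0Sn R 1)) E_inf.
(* [C] bounds [v] at every remainder modulo [m.+1]; dividing by [n] makes it negligible. *)
pose C := m.+1%:R * v 1%N + v 0%N.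
have C_ge0 : 0 <= C by rewrite addr_ge0 // mulr_ge0.
near=> n.
have n_gt0 : (0 < n)%N by near: n; exact: nbhs_infty_ge.
have nR_gt0 : 0 < n%:R :> R by rewrite ltr0n.
have Cn : C / n%:R <= eps / 2.
  rewrite ler_pdivrMr // mulrC -ler_pdivrMr ?divr_gt0 //.
  by near: n; exact: nbhs_infty_ger.
have le_n : inf E <= v n / n%:R.
  by apply: ge_inf; [exact: E_inf.2|exists n.-1; rewrite // prednK].
rewrite distrC ger0_norm ?subr_ge0 // lerBlDl.
have v_r r : (r < m.+1)%N -> v r <= C.
  move=> rm; have := v_mul 1%N r 0%N; rewrite muln1 addn0 => /le_trans; apply.
  by rewrite lerD2r ler_wpM2r // ler_nat ltnW.
have vn : v n <= (n %/ m.+1)%:R * v m.+1 + C.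
  rewrite {1}(divn_eq n m.+1); apply: le_trans (v_mul _ _ _) _.
  by rewrite lerD2l v_r // ltn_pmod.
have qn : (n %/ m.+1)%:R * v m.+1 / n%:R <= v m.+1 / m.+1%:R.
  rewrite ler_pdivrMr // mulrAC -mulrA mulrC ler_wpM2l //.
  by rewrite ler_pdivlMr // -natrM ler_nat leq_trunc_div.
rewrite (splitr eps) addrA.
apply: (@le_trans _ _ (((n %/ m.+1)%:R * v m.+1 + C) / n%:R)).
  by rewrite ler_pM2r ?invr_gt0.
by rewrite mulrDl lerD // (le_trans qn) // ltW.
Unshelve. all: by end_near.
Qed.

End Fekete.

Section GrowthRate.
Variables (R : realType) (G : groupType) (A : {fset G}).
Local Open Scope classical_set_scope.
Local Open Scope ring_scope.

(** Needed because [lim] is meaningful only for convergent sequences. The logarithm of the growth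
    function is subadditive. *)
Lemma cvg_growth :
  cvg ((growth_function A n)%:R `^ (n%:R^-1) @[n --> \oo] : set_system R).
Proof.
pose v n : R := ln (growth_function A n)%:R.
have growth_pos n : 0 < (growth_function A n)%:R :> R by rewrite ltr0n growth_gt0.
have -> : (fun n => (growth_function A n)%:R `^ (n%:R^-1) : R) =
    (fun n => expR (v n / n%:R)).
  by apply/funext => n; rewrite /powR gt_eqF // mulrC.
have [|l vl] := (cvg_ex (v n / n%:R @[n --> \oo] : set_system R)).1.
  apply: fekete => [n|m n].
    by rewrite ln_ge0 // ler1n growth_gt0.
  by rewrite -lnM ?posrE // ler_ln ?posrE ?mulr_gt0 // -natrM ler_nat growth_submul.
by apply: (@cvgP _ _ (expR l)); apply: cvg_comp vl _; exact: continuous_expR.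
Qed.

Lemma growth_rate_ge k c : (0 < k)%N ->
  (forall n, c ^ n <= growth_function A n ^ k)%N ->
  c%:R `^ k%:R^-1 <= growth_rate R A.
Proof.
move=> k_gt0 ck; apply: limr_ge; first exact: cvg_growth.
near=> n; have n_gt0 : (0 < n)%N by near: n; exact: nbhs_infty_ge.
have nR : n%:R != 0 :> R by rewrite pnatr_eq0 -lt0n.
have kR : k%:R != 0 :> R by rewrite pnatr_eq0 -lt0n.
(* With [t = 1 / (n k)], both sides become [t]-th powers, of [c ^ n] and of the [k]-th power of the
   growth function. *)
have [t t_ge0 [-> ->]] : exists2 t : R, 0 <= t &
    k%:R^-1 = n%:R * t /\ n%:R^-1 = k%:R * t.
  exists (n%:R^-1 * k%:R^-1); first by rewrite mulr_ge0.
  by rewrite mulrA divff // mul1r mulrCA divff // mulr1.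
rewrite !powRrM !powR_mulrn //; apply: ge0_ler_powR => //.
- by rewrite nnegrE exprn_ge0.
- by rewrite nnegrE exprn_ge0.
- by rewrite -!natrX ler_nat ck.
Unshelve. all: by end_near.
Qed.

End GrowthRate.

(** * Subgroups of free-by-cyclic groups *)

Section Isomorphisms.

Lemma isomorphic_of_bij (G H : groupType) (f : G -> H) :
  {morph f : x y / x * y} -> (forall x, f x = 1 -> x = 1) ->
  (forall y, exists x, f x = y) -> isomorphic H G.
Proof.
move=> fM f1 f_surj; have [f' f'K] := choice f_surj.
have f_inj := morph_inj fM f1.
have f'M : {morph f' : x y / x * y}.
  by move=> x y; apply: f_inj; rewrite fM !f'K.
pose h : {multiplicative H -> G} := HB.pack f' (isMultiplicative.Build H G f' f'M).
by exists h; exists f => // x; apply: f_inj; rewrite f'K.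
Qed.

Lemma isomorphic_unit (H : groupType) : (forall x : H, x = 1) -> isomorphic H unit.
Proof.
by move=> H1; apply: (@isomorphic_of_bij _ _ (fun=> 1)) => [x y|[]|y].
Qed.

Lemma zpow_zgroup (m n : int) : zpow (m : Zgroup) n = (m * n)%R.
Proof. by rewrite -{1}[m]zpow_int -zpowM zpow_int. Qed.

Lemma isomorphic_Z (H : groupType) (t : H) : (forall n, zpow t n = 1 -> n = 0%R) ->
  (forall x, exists n, x = zpow t n) -> isomorphic H Zgroup.
Proof.
move=> t_free t_gen; apply: (@isomorphic_of_bij Zgroup _ (zpow t)).
- by move=> m n; rewrite -zpowD.
- exact: t_free.
- by move=> x; have [n ->] := t_gen x; exists n.
Qed.

Section RankTwo.
Variables (H : groupType) (u t : H).
Hypothesis ut_free :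
  forall m n, zpow u m * zpow t n = 1 -> m = 0%R /\ n = 0%R.
Hypothesis ut_gen : forall x, exists m n, x = zpow u m * zpow t n.

Lemma isomorphic_ZZ : commute u t -> isomorphic H (Zgroup * Zgroup)%type.
Proof.
move=> ut; have com m n : commute (zpow u m) (zpow t n).
  have V k : commute (zpow u k) t.
    apply: commute_sym; case: k => k; first exact/commuteX/commute_sym.
    exact/commuteV/commuteX/commute_sym.
  by case: n => k; [exact: commuteX|exact/commuteV/commuteX].
apply: (@isomorphic_of_bij (Zgroup * Zgroup)%type _
  (fun k => zpow u k.1 * zpow t k.2)) => [[m n] [m' n']|[m n]|x].
- rewrite /= !zpowD !mulgA; congr (_ * _); rewrite -!mulgA; congr (_ * _).
  exact: com.
- by move=> /ut_free[/= -> ->].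
- by have [m [n ->]] := ut_gen x; exists (m, n).
Qed.

(** The defining relation holds for [u] and [t], so evaluating words is a morphism onto [H]. Every
    class has the form [zpow a m * zpow b n], and [ut_free] makes the kernel trivial. *)
Lemma isomorphic_klein : u ^ t = u^-1 -> isomorphic H klein_bottle_group.
Proof.
move=> utV; pose g b := if b then t else u.
have g_rel v w : klein_rel v w -> eval g v = eval g w.
  move=> [-> ->]; rewrite !eval_cons eval_nil /letter /= !mulg1.
  by apply: (@conjg_inj _ t); rewrite conjVg utV invgK conjgE !mulgA mulVg mul1g mulgVK.
pose f (q : klein_bottle_group) := eval g (repr q).
have f_word_class w : f (word_class klein_rel w) = eval g w.
  exact/(eval_word_eq g_rel)/repr_word_class.
have fM : {morph f : x y / x * y}.
  move=> x y; rewrite -{1}(word_classK x) -{1}(word_classK y) -word_class_cat.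
  by rewrite f_word_class eval_cat.
pose a := word_class klein_rel [:: (false, false)].
pose b := word_class klein_rel [:: (true, false)].
have fa : f a = u by rewrite f_word_class eval_cons eval_nil mulg1.
have fb : f b = t by rewrite f_word_class eval_cons eval_nil mulg1.
have f_ab m n : f (zpow a m * zpow b n) = zpow u m * zpow t n.
  by rewrite fM !(zpow_morph _ _ fM) fa fb.
have abV : a ^ b^-1 = a^-1.
  rewrite conjgE invgK /a /b -!word_class_inv.
  rewrite -(word_class_cat _ [:: (false, false)]) -word_class_cat; apply/word_classP.
  exact: (@word_eq_rel _ klein_rel [::] [::] _ _ (conj erefl erefl)).
have aV : a ^ b = a^-1 by apply: (@conjg_inj _ b^-1); rewrite conjgK conjVg abV invgK.
have norm q : exists m n, q = zpow a m * zpow b n.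
  rewrite -(word_classK q) -eval_word_class.
  elim: (repr q) => [|[c e] w [m [n IH]]].
    by exists 0%R, 0%R; rewrite eval_nil mulg1.
  rewrite eval_cons IH; case: c e => [] [].
  - exists (- m)%R, (- 1 + n)%R; rewrite zpowN zpowD zpowN zpow1.
    by rewrite -[in RHS]zpowV -aV -zpow_conj conjgE !mulgA mulgK.
  - exists (- m)%R, (1 + n)%R; rewrite zpowN zpowD zpow1.
    by rewrite -[in RHS]zpowV -abV -zpow_conj conjgE invgK !mulgA mulgVK.
  - by exists (- 1 + m)%R, n; rewrite zpowD zpowN zpow1 -!mulgA.
  - by exists (1 + m)%R, n; rewrite zpowD zpow1 -!mulgA.
apply: (isomorphic_of_bij fM) => [q|x].
  by have [m [n ->]] := norm q; rewrite f_ab => /ut_free[-> ->]; rewrite mulg1.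
by have [m [n ->]] := ut_gen x; exists (zpow a m * zpow b n).
Qed.

End RankTwo.
End Isomorphisms.

(** * Groups whose kernel over the integers embeds in a free group *)

Section FreeByCyclic.
Variables (F H : groupType) (p : H -> Zgroup) (j : H -> F).
Hypothesis freeF : is_free F.
Hypothesis pM : {morph p : x y / x * y}.
Hypothesis jM : forall x y, p x = 1 -> j (x * y) = j x * j y.
Hypothesis j_inj : forall x y, p x = 1 -> p y = 1 -> j x = j y -> x = y.
Implicit Types (x y z u t : H) (A : {fset H}).

Let p1 : p 1 = 1.
Proof. exact: morph_one. Qed.

Let pV x : p x = 1 -> p x^-1 = 1.
Proof. by move=> px; rewrite morph_inv // px invg1. Qed.

Let j1 : j 1 = 1.
Proof. by apply: (@mulgI _ (j 1)); rewrite -jM // !mulg1. Qed.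

Let jV x : p x = 1 -> j x^-1 = (j x)^-1.
Proof. by move=> px; apply: (@mulgI _ (j x)); rewrite -jM // !mulgV j1. Qed.

Lemma kernel_conj x y : p x = 1 -> p (x ^ y) = 1.
Proof. by move=> px; rewrite conjgE !pM px mul1g -pM mulVg. Qed.

(** [j] is assumed multiplicative only when the left factor lies in the kernel of [p], so words are
    transported to [F] only for elements of that kernel. *)
Lemma kernel_eval (g : bool -> H) w : (forall b, p (g b) = 1) ->
  p (eval g w) = 1 /\ j (eval g w) = eval (j \o g) w.
Proof.
move=> pg; elim: w => [|[b e] w [IHp IHj]]; first by rewrite !eval_nil.
have pl : p (letter g (b, e)) = 1 by case: e; rewrite /letter /= ?pV.
rewrite !eval_cons pM jM // pl IHp IHj mulg1; split=> //; congr (_ * _).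
by case: e {pl}; rewrite /letter //= jV.
Qed.

Lemma kernel_zpow x n : p x = 1 -> p (zpow x n) = 1 /\ j (zpow x n) = zpow (j x) n.
Proof.
move=> px; have := @kernel_eval (fun=> x) (word_zpow n false) (fun=> px).
by rewrite !eval_word_zpow.
Qed.

Lemma kernel_commute x y : p x = 1 -> p y = 1 ->
  commute (j x) (j y) <-> commute x y.
Proof.
move=> px py; rewrite /commute -!jM //; split=> [|->//].
by apply: j_inj; rewrite pM px py mulg1.
Qed.

Lemma kernel_free_pair (g : bool -> H) : (forall b, p (g b) = 1) ->
  ~ commute (g false) (g true) -> free_pair g.
Proof.
move=> pg ncom; have [jg_free|/(cyclic_pair_commute false true)] :=
  free_dichotomy freeF (j \o g).
  by move=> Q a w gw; apply: jg_free; have [_ <-] := kernel_eval w pg; rewrite gw j1.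
by rewrite /= kernel_commute.
Qed.

Lemma kernel_commute_trans x y z : p x = 1 -> p y = 1 -> p z = 1 -> y != 1 ->
  commute x y -> commute y z -> commute x z.
Proof.
move=> px py pz y1; rewrite -!kernel_commute //; apply: commute_free_trans => //.
by apply: contraNneq y1 => jy1; apply/eqP/j_inj; rewrite ?j1.
Qed.

Lemma kernel_abelian A : generates A ->
  (forall x y, word_ball A 6 x -> word_ball A 6 y -> p x = 1 -> p y = 1 ->
    commute x y) ->
  forall x y, p x = 1 -> p y = 1 -> commute x y.
Proof.
move=> genA com6.
have ind (P : H -> Prop) : P 1 ->
    (forall x y, (x \in A) || (x^-1 \in A) -> P y -> P (x * y)) -> forall x, P x.
  by move=> P1 PM x; have [n xn] := genA x; exact: word_ball_ind P1 PM n x xn.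
have [comA|] := pselect (forall x y, (x \in A) || (x^-1 \in A) ->
    (y \in A) || (y^-1 \in A) -> commute x y).
  move=> x y _ _; move: x y; apply: (ind) => [y|x x' xA com y].
    exact/commute_sym/commute1.
  apply/commute_sym/commuteM; last exact/commute_sym.
  move: y; apply: (ind) => [|y y' yA com']; first exact/commute_sym/commute1.
  by apply/commute_sym/commuteM; [exact: comA|exact/commute_sym].
move=> /existsNP[x /existsNP[y /not_implyP[xA /not_implyP[yA xy]]]].
pose c := [~ x, y].
have VA z : (z \in A) || (z^-1 \in A) -> (z^-1 \in A) || (z^-1^-1 \in A).
  by rewrite invgK orbC.
have c4 : word_ball A 4 c.
  by rewrite /c commgEl conjgE; do 3?[apply: (@word_ballM _ _ 1)];
    apply: word_ball_gen; rewrite ?VA.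
have pc : p c = 1.
  rewrite /c commgEl conjgE !pM !morph_inv //.
  have cancel (m n : int) : (- m + (- n + (m + n)) = 0)%R by lia.
  exact: cancel.
have c1 : c != 1 by apply/eqP => /eqP/commgP.
(* The length is 4 + 2 = 6, the radius in the hypothesis. *)
have comc z : (z \in A) || (z^-1 \in A) -> commute (c ^ z) c.
  move=> zA; apply: com6; rewrite ?kernel_conj //; last exact: word_ball_leq c4.
  rewrite conjgE; apply: (@word_ballM _ _ 1 5); first exact/word_ball_gen/VA.
  by apply: (@word_ballM _ _ 4 1) => //; exact: word_ball_gen.
(* The centraliser of [c] in the kernel is normal: [z ^ h] commutes with [c ^ h], which is
   nontrivial and commutes with [c] when [h] is a generator. *)
have normal h : forall z, p z = 1 -> commute z c -> commute (z ^ h) c.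
  move: h; apply: (ind) => [z|h h' hA IH z pz zc]; first by rewrite conjg1.
  rewrite conjgM; apply: IH; first exact: kernel_conj.
  apply: (@kernel_commute_trans _ (c ^ h)); rewrite ?kernel_conj ?conjg_eq1 //.
    by rewrite /commute -!conjMg zc.
  exact: comc.
(* Normality applied to [c] itself shows that [c ^ h] commutes with [c], and [commute_free_conj]
   applies since [h] is in the kernel. *)
have centc h : p h = 1 -> commute c h.
  move=> ph; apply/kernel_commute => //; apply: (commute_free_conj freeF).
  have -> : j c ^ j h = j (c ^ h).
    by rewrite !conjgE (jM _ (pV ph)) (jM _ pc) jV.
  by apply/kernel_commute => //; [exact: kernel_conj|exact: normal].
move=> x' y' px' py'; apply: (@kernel_commute_trans _ c) => //.
  exact/commute_sym/centc.
exact: centc.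
Qed.

Lemma kernel_cyclic : (forall x y, p x = 1 -> p y = 1 -> commute x y) ->
  exists u, p u = 1 /\ forall x, p x = 1 -> exists n, x = zpow u n.
Proof.
move=> com; pose P f := exists2 x, p x = 1 & j x = f.
have P_sub : is_subgroup P.
  split=> [|_ _ [x px <-] [y py <-]|_ [x px <-]]; first by exists 1.
    by exists (x * y); [rewrite pM px py mulg1|rewrite jM].
  by exists x^-1; [exact: pV|exact: jV].
have [_ _ [x px <-] [y py <-]|_ [[u pu <-] u_gen]] := free_abelian_cyclic freeF P_sub.
  by apply/kernel_commute => //; exact: com.
exists u; split=> // x px; have [|n jx] := u_gen (j x); first by exists x.
have [pn jn] := kernel_zpow n pu; by exists n; apply: j_inj; rewrite ?jn.
Qed.

(** Take [t] with the least nonzero absolute value of [p t] and divide with remainder; if [p] is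
    trivial, [t = 1] serves. *)
Lemma image_cyclic : exists t, forall x, exists n : int, p x = (n * p t)%R.
Proof.
have [ex|nex] := pselect (exists x, p x != 0%R); last first.
  exists 1 => x; exists 0%R; rewrite GRing.mul0r; apply: contrapT => px; apply: nex.
  by exists x; apply/eqP.
pose Q n := `[< exists x, p x != 0%R /\ absz (p x) = n >].
have exQ : exists n, Q n.
  by have [x px] := ex; exists (absz (p x)); apply/asboolP; exists x.
case: (ex_minnP exQ) => n /asboolP[t [pt ptn]] min.
exists t => x; exists (p x %/ p t)%Z.
have prest : p (x * zpow t (- (p x %/ p t)%Z)%R) = (p x %% p t)%Z.
  rewrite pM (zpow_morph _ _ pM) zpow_zgroup.
  rewrite -[LHS]/(p x + p t * - (p x %/ p t)%Z)%R {1}(divz_eq (p x) (p t)); lia.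
rewrite {1}(divz_eq (p x) (p t)); have [->|r_neq0] := eqVneq (p x %% p t)%Z 0%R.
  exact: GRing.addr0.
have : n <= absz (p x %% p t)%Z.
  apply: min; apply/asboolP; exists (x * zpow t (- (p x %/ p t)%Z)%R).
  by rewrite prest.
have := ltz_mod (p x) pt; have := modz_ge0 (p x) pt; lia.
Qed.

Lemma abelian_kernel_isomorphic : (forall x y, p x = 1 -> p y = 1 -> commute x y) ->
  [\/ isomorphic H unit, isomorphic H Zgroup, isomorphic H (Zgroup * Zgroup)%type
    | isomorphic H klein_bottle_group].
Proof.
move=> /kernel_cyclic[u [pu u_gen]]; have [t t_gen] := image_cyclic.
have p_zpow m : p (zpow t m) = (p t * m)%R by rewrite (zpow_morph _ _ pM) zpow_zgroup.
have ut_gen x : exists m n, x = zpow u m * zpow t n.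
  have [n pxn] := t_gen x; have [|m xm] := u_gen (x * zpow t (- n)%R).
    rewrite pM p_zpow pxn -[LHS]/(n * p t + p t * - n)%R -[RHS]/(0%R : int); lia.
  by exists m, n; rewrite -xm zpowN mulgVK.
have u_free : u != 1 -> forall n, zpow u n = 1 -> n = 0%R.
  move=> u1 n /(congr1 j); rewrite (kernel_zpow n pu).2 j1.
  apply: (free_zpow_eq1 freeF); apply: contraNneq u1 => ju.
  by apply/eqP/j_inj; rewrite ?j1.
have t_free : p t != 0%R -> forall n, p (zpow t n) = 1 -> n = 0%R.
  move=> pt n /eqP; rewrite p_zpow -[1]/(0%R : int) GRing.mulf_eq0 (negPf pt).
  by move=> /eqP.
(* If [p t] is zero, [H] is its own kernel, hence cyclic. *)
have [pt|pt] := eqVneq (p t) (0%R : int).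
  have {}u_gen x : exists n, x = zpow u n.
    by apply: u_gen; have [n ->] := t_gen x; rewrite pt; exact: GRing.mulr0.
  have [u1|u1] := eqVneq u 1; last by constructor 2; exact: isomorphic_Z (u_free u1) _.
  constructor 1; apply: isomorphic_unit => x; have [n ->] := u_gen x.
  by rewrite u1 zpow1g.
have {}t_free n : p (zpow t n) = 1 -> n = 0%R := t_free pt n.
have [u1|u1] := eqVneq u 1.
  constructor 2; apply: (@isomorphic_Z _ t) => [n tn|x].
    by apply: t_free; rewrite tn.
  by have [m [n ->]] := ut_gen x; exists n; rewrite u1 zpow1g mul1g.
have ut_free m n : zpow u m * zpow t n = 1 -> m = 0%R /\ n = 0%R.
  move=> mn; have n0 : n = 0%R.
    apply: t_free; have := congr1 p mn.
    by rewrite pM (kernel_zpow m pu).1 mul1g p1.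
  by split=> //; apply: u_free => //; rewrite -mn n0 mulg1.
have [m um] := u_gen _ (kernel_conj t pu).
have [n un] := u_gen _ (kernel_conj t^-1 pu).
(* Conjugating by [t] and back fixes [u], so the two exponents are inverse integers. *)
have nm : (n * m - 1 = 0)%R.
  apply: u_free => //; rewrite zpowD zpowM -un -zpow_conj.
  by rewrite -um conjgK zpowN zpow1 mulgV.
have [m1|mN1] : m = 1%R \/ m = (-1)%R.
  have /eqP : (absz n * absz m)%N = 1%N by rewrite -abszM; lia.
  by rewrite muln_eq1 => /andP[_ /eqP]; lia.
- constructor 3; apply: (isomorphic_ZZ ut_free ut_gen).
  by rewrite /commute conjgC um m1 zpow1.
- constructor 4; apply: (isomorphic_klein ut_free ut_gen).
  by rewrite um mN1 zpowN zpow1.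
Qed.

End FreeByCyclic.

Local Open Scope ring_scope.

Theorem proposition4p1 (R : realType) (F : groupType) (freeF : is_free F)
    (phi : autaction Zgroup F) (S : {pred sdprod phi}) (H : subGroupType S)
    (fgH : finitely_generated H) :
  ~ isomorphic H unit ->
  ~ isomorphic H Zgroup ->
  ~ isomorphic H (Zgroup * Zgroup)%type ->
  ~ isomorphic H klein_bottle_group ->
  3%:R `^ (6%:R^-1) <= growth_constant H R.
Proof.
move=> H1 HZ HZ2 HK; apply: lb_le_inf.
  (* The infimum is taken over a nonempty set because [H] is finitely generated. *)
  by have [A genA] := fgH; exists (growth_rate R A); exists A.
move=> _ [A genA <-].
pose p (x : H) : Zgroup := (val x).2; pose j (x : H) : F := (val x).1.
have pM : {morph p : x y / (x * y)%g} by move=> x y; rewrite /p valM.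
have jM x y : p x = 1%g -> j (x * y)%g = (j x * j y)%g.
  by rewrite /p /j valM /= => ->; rewrite act_one.
have j_inj x y : p x = 1%g -> p y = 1%g -> j x = j y -> x = y.
  rewrite /p /j => px py jxy; apply: val_inj.
  by rewrite [val x]surjective_pairing [val y]surjective_pairing px py jxy.
have [com6|] := pselect (forall x y, word_ball A 6 x -> word_ball A 6 y ->
    p x = 1%g -> p y = 1%g -> commute x y).
  by have [] := abelian_kernel_isomorphic freeF pM jM j_inj
    (kernel_abelian freeF pM jM j_inj genA com6).
move=> /existsNP[x /existsNP[y /not_implyP[x6 /not_implyP[y6]]]].
move=> /not_implyP[px /not_implyP[py xy]].
pose g (b : bool) := if b then y else x.
have g_free : free_pair g by apply: (kernel_free_pair freeF pM jM j_inj) => // -[].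
by apply: growth_rate_ge => // n; apply: free_pair_growth g_free _; case.
Qed.
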